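(* Let $\lambda_1,\lambda_2\in[0,1]$, $\Phi\in\mathbb T$ irrational, $\theta\in\mathbb T$, and suppose $\psi\in\mathscr H_1$ satisfies $W_{\lambda_1,\lambda_2,\Phi,\theta}\psi=z\psi$ for some $z\in\partial\mathbb D$. For $\xi\in\mathbb T$ define the sequence $\varphi^\xi\in\mathbb C^{\mathbb Z}\otimes\mathbb C^2$ by $$\begin{bmatrix}\varphi_n^{\xi,+}\\ \varphi_n^{\xi,-}\end{bmatrix}=\frac{1}{\sqrt2}e^{2\pi in\theta}\begin{bmatrix}1&i\\ i&1\end{bmatrix}\begin{bmatrix}\check\psi^+(n\Phi+\xi)\\ \check\psi^-(n\Phi+\xi)\end{bmatrix},\qquad n\in\mathbb Z,$$ where $\check f(x)=\sum_{n\in\mathbb Z}e^{2\pi inx}f_n$ denotes the inverse Fourier transform (an $L^2(\mathbb T)$ function for $f\in\ell^2(\mathbb Z)$). Then $W^\sharp_{\lambda_1,\lambda_2,\Phi,\xi}\varphi^\xi=z\varphi^\xi$ (as a finite difference equation) for Lebesgue-a.e. $\xi\in\mathbb T$. If moreover $\psi\in\ell^1(\mathbb Z,\mathbb C^2)$, then this holds for every $\xi\in\mathbb T$.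
   Context: Let $\mathbb T=\mathbb R/\mathbb Z$ and $\partial\mathbb D=\{z\in\mathbb C:|z|=1\}$. Let $\mathscr H_1=\ell^2(\mathbb Z)\otimes\mathbb C^2$ with orthonormal basis $\delta_n^{s}=\delta_n\otimes e_s$ ($n\in\mathbb Z$, $s\in\{+,-\}$), $e_+=(1,0)^\top$, $e_-=(0,1)^\top$; write $\psi_n^s=\langle\delta_n^s,\psi\rangle$ and $\psi_n=(\psi_n^+,\psi_n^-)^\top$. For $\lambda\in[0,1]$ put $\lambda'=\sqrt{1-\lambda^2}$ and let $S_\lambda$ be the unitary operator with $S_\lambda\delta_n^\pm=\lambda\delta_{n\pm1}^\pm\pm\lambda'\delta_n^\mp$. For $\lambda_2\in[0,1]$, $\Phi,\theta\in\mathbb T$, $n\in\mathbb Z$ let $$Q_n=Q_{\lambda_2,\Phi,\theta,n}=\begin{bmatrix}\lambda_2\cos(2\pi(n\Phi+\theta))+i\lambda_2' & -\lambda_2\sin(2\pi(n\Phi+\theta))\\ \lambda_2\sin(2\pi(n\Phi+\theta)) & \lambda_2\cos(2\pi(n\Phi+\theta))-i\lambda_2'\end{bmatrix},$$ and let $Q_{\lambda_2,\Phi,\theta}$ act by $(Q\psi)_n=Q_n\psi_n$. The unitary almost-Mathieu operator is $W_{\lambda_1,\lambda_2,\Phi,\theta}=S_{\lambda_1}Q_{\lambda_2,\Phi,\theta}$ on $\mathscr H_1$, for $\lambda_1,\lambda_2\in[0,1]$. Transposes are taken with respect to the basis $\{\delta_n^s\}$. For a walk $W=S_\lambda Q$ with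 coins $Q_n=(q_n^{jk})_{j,k=1,2}$, the transpose acts (on arbitrary sequences, as a finite difference operator) by $[W^\top\psi]_n^+=q_n^{11}(\lambda\psi_{n+1}^++\lambda'\psi_n^-)+q_n^{21}(-\lambda'\psi_n^++\lambda\psi_{n-1}^-)$ and $[W^\top\psi]_n^-=q_n^{12}(\lambda\psi_{n+1}^++\lambda'\psi_n^-)+q_n^{22}(-\lambda'\psi_n^++\lambda\psi_{n-1}^-)$. The dual operator is $W^\sharp_{\lambda_1,\lambda_2,\Phi,\theta}:=W^\top_{\lambda_2,\lambda_1,\Phi,\theta}$ (note the exchange of $\lambda_1$ and $\lambda_2$). *)

(* Defs.v *)
From HB Require Import structures.
From mathcomp Require Import all_boot all_order all_algebra.
From mathcomp Require Import all_classical all_reals all_analysis.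
From mathcomp Require Import complex.
Set Implicit Arguments.
Unset Strict Implicit.
Unset Printing Implicit Defensive.
Import Order.TTheory GRing.Theory Num.Theory.
Local Open Scope ring_scope.
Local Open Scope complex_scope.

Definition sqn {R : realType} (z : R[i]) : R :=
  complex.Re z ^+ 2 + complex.Im z ^+ 2.

Definition e2pi {R : realType} (x : R) : R[i] :=
  cos (2 * pi * x) +i* sin (2 * pi * x).

Definition lamc {R : realType} (l : R) : R := Num.sqrt (1 - l ^+ 2).

(* a C^2-valued sequence on Z: (psi n).1 = psi_n^+, (psi n).2 = psi_n^- *)
Definition cseq2 (R : realType) := int -> (R[i] * R[i])%type.

Definition ang {R : realType} (Phi theta : R) (n : int) : R :=
  2 * pi * (n%:~R * Phi + theta).

Definition q11 {R : realType} (l2 Phi theta : R) (n : int) : R[i] :=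
  (l2 * cos (ang Phi theta n)) +i* (lamc l2).
Definition q12 {R : realType} (l2 Phi theta : R) (n : int) : R[i] :=
  (- (l2 * sin (ang Phi theta n)))%:C.
Definition q21 {R : realType} (l2 Phi theta : R) (n : int) : R[i] :=
  (l2 * sin (ang Phi theta n))%:C.
Definition q22 {R : realType} (l2 Phi theta : R) (n : int) : R[i] :=
  (l2 * cos (ang Phi theta n)) +i* (- lamc l2).

Definition coinop {R : realType} (l2 Phi theta : R) (psi : cseq2 R) : cseq2 R :=
  fun n => (q11 l2 Phi theta n * (psi n).1 + q12 l2 Phi theta n * (psi n).2,
            q21 l2 Phi theta n * (psi n).1 + q22 l2 Phi theta n * (psi n).2).

(* shift S_l, from S_l delta_n^{+-} = l delta_{n+-1}^{+-} +- l' delta_n^{-+} *)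
Definition shiftop {R : realType} (l : R) (chi : cseq2 R) : cseq2 R :=
  fun n => (l%:C * (chi (n - 1)%R).1 - (lamc l)%:C * (chi n).2,
            l%:C * (chi (n + 1)%R).2 + (lamc l)%:C * (chi n).1).

Definition Wamo {R : realType} (l1 l2 Phi theta : R) (psi : cseq2 R) : cseq2 R :=
  shiftop l1 (coinop l2 Phi theta psi).

Definition Wtrans {R : realType} (l lc Phi theta : R) (psi : cseq2 R) : cseq2 R :=
  fun n =>
    let a := l%:C * (psi (n + 1)%R).1 + (lamc l)%:C * (psi n).2 in
    let b := - ((lamc l)%:C * (psi n).1) + l%:C * (psi (n - 1)%R).2 in
    (q11 lc Phi theta n * a + q21 lc Phi theta n * b,
     q12 lc Phi theta n * a + q22 lc Phi theta n * b).

Definition Wsharp {R : realType} (l1 l2 Phi theta : R) (psi : cseq2 R) : cseq2 R :=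
  Wtrans l2 l1 Phi theta psi.

Definition fpsum {R : realType} (f : int -> R[i]) (N : nat) (x : R) : R[i] :=
  \sum_(k < (2 * N).+1) e2pi ((k%:Z - N%:Z)%:~R * x) * f (k%:Z - N%:Z)%R.

Definition is_l2 {R : realType} (psi : cseq2 R) : Prop :=
  exists M : R, forall N : nat,
    \sum_(k < (2 * N).+1)
       (sqn (psi (k%:Z - N%:Z)%R).1 + sqn (psi (k%:Z - N%:Z)%R).2) <= M.

Definition is_l1 {R : realType} (psi : cseq2 R) : Prop :=
  exists M : R, forall N : nat,
    \sum_(k < (2 * N).+1)
       (Num.sqrt (sqn (psi (k%:Z - N%:Z)%R).1)
        + Num.sqrt (sqn (psi (k%:Z - N%:Z)%R).2)) <= M.

(* g : R -> C is a (1-periodic, measurable) representative of the L^2(T)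
   function f-check, i.e. the L^2(T)-limit of the partial sums fpsum f N *)
Definition is_inv_fourier_L2 {R : realType} (f : int -> R[i]) (g : R -> R[i]) : Prop :=
  [/\ (forall x : R, g (x + 1) = g x),
      measurable_fun setT (fun x : R => complex.Re (g x)),
      measurable_fun setT (fun x : R => complex.Im (g x)) &
      (forall eps : R, 0 < eps -> exists N0 : nat, forall N : nat, (N0 <= N)%N ->
         (\int[lebesgue_measure]_(x in `[0%R, 1%R])
             (sqn (fpsum f N x - g x))%:E < eps%:E)%E)].

Definition is_inv_fourier_pw {R : realType} (f : int -> R[i]) (g : R -> R[i]) : Prop :=
  forall x : R, forall eps : R, 0 < eps -> exists N0 : nat, forall N : nat,
    (N0 <= N)%N -> sqn (fpsum f N x - g x) < eps.

(* the sequence phi^xi built from representatives gp, gm of psi^+-check, psi^--check *)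
Definition phixi {R : realType} (Phi theta : R) (gp gm : R -> R[i]) (xi : R) : cseq2 R :=
  fun n =>
    let c := (Num.sqrt 2)^-1%:C * e2pi (n%:~R * theta) in
    let u := gp (n%:~R * Phi + xi) in
    let v := gm (n%:~R * Phi + xi) in
    (c * (u + 'i * v), c * ('i * u + v)).

(* Main.v *)
Require Import Defs.
From HB Require Import structures.
From mathcomp Require Import all_boot all_order all_algebra.
From mathcomp Require Import all_classical all_reals all_analysis.
From mathcomp Require Import measurable_realfun.
From mathcomp Require Import complex ring lra zify.
Set Implicit Arguments.
Unset Strict Implicit.
Unset Printing Implicit Defensive.
Import Order.TTheory GRing.Theory Num.Theory.
Local Open Scope ring_scope.
Local Open Scope complex_scope.

(** Write [g] for the inverse Fourier transform of [f]. Multiplying [f n] by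
  [e2pi (n * a)] translates [g] by [a], and shifting [f] by one multiplies [g]
  by [e2pi (+-x)]. As the coins are trigonometric polynomials in [n * Phi], the
  eigenvalue equation [W psi = z psi] therefore becomes two functional equations
  relating the transforms of [psi] at [x - Phi], [x] and [x + Phi]; at
  [x = n * Phi + xi], after the unitary change of basis (1, i; i, 1) / sqrt 2,
  they are the two components at [n] of the dual equation. The rules for
  transforms hold both for L^2 limits and for pointwise limits of the partial
  sums, the shift rule because its two boundary terms vanish for an [f] tending
  to 0 at infinity. Uniqueness of limits, almost everywhere in the first case,
  gives the two claims. *)

(** * Translation invariance of Lebesgue measure and integrals of periodic functions *)

Section translation.
Context {R : realType}.
Implicit Types (A D : set R) (h : R -> \bar R) (a : R) (m : int).
Local Notation mu := lebesgue_measure.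
Local Open Scope classical_set_scope.

Lemma measurable_addr a :
  measurable_fun setT ((fun x => x + a) : measurableTypeR R -> measurableTypeR R).
Proof. exact: measurable_funD. Qed.

Lemma preimage_addr_itv a (b1 b2 : bool) (c d : R) :
  (fun x => x + a) @^-1` [set` Interval (BSide b1 c) (BSide b2 d)] =
  [set` Interval (BSide b1 (c - a)) (BSide b2 (d - a))].
Proof.
apply/seteqP; split=> x /=; rewrite !in_itv/=;
  by case: b1; case: b2 => /=; rewrite ?lerBlDr ?ltrBlDr ?lerBrDr ?ltrBrDr.
Qed.

(** By uniqueness of Lebesgue measure, it suffices to compare the two measures on half-open
    intervals, whose length a translation preserves. *)
Lemma lebesgue_measure_addr a A : measurable A ->
  pushforward mu ((fun x => x + a) : measurableTypeR R -> measurableTypeR R) A = mu A.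
Proof.
move=> mA; apply/esym/(@lebesgue_measure_unique _
  (measure_function_pushforward__canonical__measure_function_Measure
     mu (measurable_addr a))) => //= _ [[c d]] _ <-.
rewrite /pushforward /= preimage_addr_itv/= !lebesgue_measure_itv/=.
rewrite !lte_fin ltrD2r; case: ifP => // _.
by rewrite -!EFinB; congr (_%:E); ring.
Qed.

Lemma ge0_integral_addr a D h : measurable D -> measurable_fun setT h ->
  (forall x, (0 <= h x)%E) ->
  (\int[mu]_(x in (fun x => (x + a)%R) @^-1` D) h (x + a)%R = \int[mu]_(x in D) h x)%E.
Proof.
move=> mD mh h0.
have /= <- := @ge0_integral_pushforward _ _ _ _ _ _ (measurable_addr a)
  lebesgue_measure D h mD (measurable_funTS mh) (fun y _ => h0 y).
apply: eq_measure_integral => [|mf A mA _]; first exact: measurable_addr.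
exact: lebesgue_measure_addr.
Qed.

Lemma periodic_int (T : Type) (h : R -> T) m x :
  (forall x, h (x + 1) = h x) -> h (x + m%:~R) = h x.
Proof.
move=> per.
have pern n y : h (y + n%:R) = h y.
  by elim: n y => [|n IH] y; rewrite ?addr0// -addn1 natrD addrA per IH.
case: m => n; first exact: pern.
by rewrite NegzE mulrNz -(pern n.+1) subrK.
Qed.

Lemma ge0_integral_periodic_int h m : measurable_fun setT h ->
  (forall x, (0 <= h x)%E) -> (forall x, h (x + 1) = h x) ->
  (\int[mu]_(x in `[m%:~R, (m%:~R + 1)%R]) h x = \int[mu]_(x in `[0%R, 1%R]) h x)%E.
Proof.
move=> mh h0 per.
rewrite -(ge0_integral_addr m%:~R) // preimage_addr_itv subrr addrAC subrr add0r.
by apply: eq_integral => x _; exact: periodic_int.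
Qed.

(* The factor 2 counts the integer unit intervals that cover [a, a + 1]. *)
Lemma ge0_integral_periodic_addr h a : measurable_fun setT h ->
  (forall x, (0 <= h x)%E) -> (forall x, h (x + 1) = h x) ->
  (\int[mu]_(x in `[0%R, 1%R]) h (x + a)%R <= 2%:E * \int[mu]_(x in `[0%R, 1%R]) h x)%E.
Proof.
move=> mh h0 per.
have -> : (\int[mu]_(x in `[0%R, 1%R]) h (x + a)%R =
    \int[mu]_(x in `[a, (a + 1)%R]) h x)%E.
  by rewrite -[RHS](ge0_integral_addr a)// preimage_addr_itv subrr addrAC subrr add0r.
set k := Num.floor a.
pose D1 : set R := `[k%:~R, k%:~R + 1]%classic.
pose D2 : set R := `[(k + 1)%:~R, (k + 1)%:~R + 1]%classic.
have mD1 : measurable D1 by exact: measurable_itv.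
have mD2 : measurable D2 by exact: measurable_itv.
(* [D1] and [D2] share the endpoint [k + 1]; removing [D1] from [D2] makes the union disjoint, so
   that the integral is additive. *)
have mD21 : measurable (D2 `\` D1) by exact: measurableD.
apply: (@le_trans _ _ (\int[mu]_(x in D1 `|` (D2 `\` D1)) h x)%E).
  apply: ge0_subset_integral => //.
  - exact: measurableU.
  - exact: measurable_funTS.
  rewrite setUDr setDv setD0 => x /=; rewrite /D1 /D2 /= !in_itv /= => /andP[ax xa].
  have := floor_le a; have := floorD1_gt a; rewrite -/k intrD => ak ka.
  by case: (leP x (k%:~R + 1)) => xk; [left|right]; apply/andP; split; lra.
rewrite ge0_integral_setU//; last 2 first.
- exact: measurable_funTS.
- by apply/disj_setPS => x [D1x [_]].
rewrite mule_natl mule2n; apply: leeD.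
  by rewrite (ge0_integral_periodic_int k mh h0 per).
rewrite -(ge0_integral_periodic_int (k + 1) mh h0 per).
apply: ge0_subset_integral => //; first exact: measurable_funTS.
Qed.

(** A zero integral over one period gives zero almost everywhere on each [[m, m + 1]], and these
    countably many intervals cover the line. *)
Lemma ae_periodic_eq0 h : measurable_fun setT h ->
  (forall x, (0 <= h x)%E) -> (forall x, h (x + 1) = h x) ->
  (\int[mu]_(x in `[0%R, 1%R]) h x = 0)%E ->
  {ae mu, forall x, h x = 0%E}.
Proof.
move=> mh h0 per int0.
have ae_int m : {ae mu, forall x, m%:~R <= x <= m%:~R + 1 -> h x = 0%E}.
  pose D : set R := `[m%:~R, m%:~R + 1]%classic.
  have mD : measurable_fun D h by exact: measurable_funTS.
  have [+ _] := ae_eq_integral_abs lebesgue_measure (measurable_itv _) mD.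
  under eq_integral do rewrite gee0_abs//.
  rewrite ge0_integral_periodic_int// => /(_ int0).
  by apply: filterS => x /= + xm; apply; rewrite in_itv.
(* The integers are enumerated by [unpickle], with 0 as the value at codes of no integer; each [x]
   then uses the code of its floor. *)
have := ae_foralln (fun n => ae_int (odflt 0 (unpickle n))).
apply: filterS => x hx; have := hx (pickle (Num.floor x)).
rewrite pickleK /=; apply; rewrite floor_le /=.
by have := floorD1_gt x; rewrite intrD /= => /ltW.
Qed.
End translation.

(** * The walk under the Fourier transform, and the dual equation at one point *)

Section algebra.
Context {R : realType}.
Local Notation C := R[i].

Lemma complexP (x y : C) :
  complex.Re x = complex.Re y -> complex.Im x = complex.Im y -> x = y.
Proof. by case: x y => [a b] [c d] /= -> ->. Qed.

Lemma e2piD (x y : R) : e2pi (x + y) = e2pi x * e2pi y.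
Proof. by rewrite /e2pi mulrDr cosD sinD; apply: complexP => /=; ring. Qed.

Lemma e2piN (x : R) : e2pi (- x) = cos (2 * pi * x) +i* (- sin (2 * pi * x)).
Proof. by rewrite /e2pi mulrN cosN sinN. Qed.

(* [P f g] reads: [g] is the inverse Fourier transform of [f]. *)
Record fourier_closed (P : (int -> C) -> (R -> C) -> Prop) : Prop := {
  fcD : forall f1 g1 f2 g2, P f1 g1 -> P f2 g2 ->
    P (fun n => f1 n + f2 n) (fun x => g1 x + g2 x);
  fcZ : forall c f g, P f g -> P (fun n => c * f n) (fun x => c * g x);
  fcM : forall a f g, P f g ->
    P (fun n => e2pi (n%:~R * a) * f n) (fun x => g (x + a));
  fcSp : forall f g, P f g -> P (fun n => f (n - 1)) (fun x => e2pi x * g x);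
  fcSm : forall f g, P f g -> P (fun n => f (n + 1)) (fun x => e2pi (- x) * g x) }.

Section walk.
Variables (l1 l2 Phi theta : R) (gp gm : R -> C).
(** Euler's formulas turn the cosine and sine of the coin into exponentials: [h] carries their
    factor 1/2, [t] and [t'] the phase of [theta]. *)
Let h := l2 / 2.
Let t := e2pi theta.
Let t' := e2pi (- theta).

(* [coin_p], [coin_m] are the transforms of the components of the coin applied to
  [psi], and [walk_p], [walk_m] those of the components of [W psi]. *)
Definition coin_p (x : R) : C :=
  h%:C * t * gp (x + Phi) + h%:C * t' * gp (x + - Phi) + 'i * (lamc l2)%:C * gp x
  + 'i * h%:C * t * gm (x + Phi) + (- ('i * h%:C) * t') * gm (x + - Phi).
Definition coin_m (x : R) : C :=
  (- ('i * h%:C) * t) * gp (x + Phi) + 'i * h%:C * t' * gp (x + - Phi)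
  + h%:C * t * gm (x + Phi) + h%:C * t' * gm (x + - Phi) + (- ('i * (lamc l2)%:C)) * gm x.

Definition walk_p (x : R) : C :=
  l1%:C * (e2pi x * coin_p x) + (- (lamc l1)%:C) * coin_m x.
Definition walk_m (x : R) : C :=
  l1%:C * (e2pi (- x) * coin_m x) + (lamc l1)%:C * coin_p x.

Lemma fourier_closed_walk P (psi : cseq2 R) : fourier_closed P ->
  P (fun n => (psi n).1) gp -> P (fun n => (psi n).2) gm ->
  P (fun n => (Wamo l1 l2 Phi theta psi n).1) walk_p /\
  P (fun n => (Wamo l1 l2 Phi theta psi n).2) walk_m.
Proof.
move=> fc Pp Pm.
have Ppp := fcM fc Phi Pp; have Ppm := fcM fc (- Phi) Pp.
have Pmp := fcM fc Phi Pm; have Pmm := fcM fc (- Phi) Pm.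
(* The constant [t] and the modulation by [Phi] combine into the exponential of the coin angle at
   [n]; [e'E] is the conjugate version. *)
have eE k n u : k * t * (e2pi (n%:~R * Phi) * u) =
    k * (cos (ang Phi theta n) +i* sin (ang Phi theta n)) * u.
  by rewrite -[_ +i* _]/(e2pi (n%:~R * Phi + theta)) e2piD -/t; ring.
have e'E k n u : k * t' * (e2pi (n%:~R * - Phi) * u) =
    k * (cos (ang Phi theta n) +i* - sin (ang Phi theta n)) * u.
  by rewrite -e2piN opprD e2piD -/t' mulrN; ring.
have Pcp : P (fun n => (coinop l2 Phi theta psi n).1) coin_p.
  have := fcD fc (fcD fc (fcD fc (fcD fc
    (fcZ fc (h%:C * t) Ppp) (fcZ fc (h%:C * t') Ppm))
    (fcZ fc ('i * (lamc l2)%:C) Pp))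
    (fcZ fc ('i * h%:C * t) Pmp)) (fcZ fc (- ('i * h%:C) * t') Pmm).
  congr (P _ _); apply/funext => n; rewrite !eE !e'E /coinop /q11 /q12 /=.
  move: (cos _) (sin _) (lamc l2) (psi n) => c s L2 [[u0 u1] [v0 v1]]; rewrite /h.
  by apply: complexP => /=; field.
have Pcm : P (fun n => (coinop l2 Phi theta psi n).2) coin_m.
  have := fcD fc (fcD fc (fcD fc (fcD fc
    (fcZ fc (- ('i * h%:C) * t) Ppp) (fcZ fc ('i * h%:C * t') Ppm))
    (fcZ fc (h%:C * t) Pmp)) (fcZ fc (h%:C * t') Pmm))
    (fcZ fc (- ('i * (lamc l2)%:C)) Pm).
  congr (P _ _); apply/funext => n; rewrite !eE !e'E /coinop /q21 /q22 /=.
  move: (cos _) (sin _) (lamc l2) (psi n) => c s L2 [[u0 u1] [v0 v1]]; rewrite /h.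
  by apply: complexP => /=; field.
split.
- have := fcD fc (fcZ fc l1%:C (fcSp fc Pcp)) (fcZ fc (- (lamc l1)%:C) Pcm).
  by congr (P _ _); apply/funext => n; rewrite /Wamo /shiftop /= mulNr.
- by have := fcD fc (fcZ fc l1%:C (fcSm fc Pcm)) (fcZ fc (lamc l1)%:C Pcp).
Qed.

(* Up to the factor [c] of [phixi], the quantities [a] and [b] in [Wtrans] are
  [coin_p x + 'i * coin_m x] and ['i * coin_p x + coin_m x]. *)
Lemma Wsharp_phixi (z : C) (xi : R) (n : int) :
  let x := n%:~R * Phi + xi in
  walk_p x = z * gp x -> walk_m x = z * gm x ->
  Wsharp l1 l2 Phi xi (phixi Phi theta gp gm xi) n
  = (z * (phixi Phi theta gp gm xi n).1, z * (phixi Phi theta gp gm xi n).2).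
Proof.
move=> x Ep Em; rewrite /Wsharp /Wtrans /phixi /=.
have -> : ((n + 1)%:~R * Phi + xi) = x + Phi by rewrite intrD /x; ring.
have -> : ((n - 1)%:~R * Phi + xi) = x + - Phi by rewrite intrB /x; ring.
(* Moving [n] by one in [phixi] changes its phase by [t] or [t'], the same constants as in [coin_p]
   and [coin_m]. *)
rewrite intrD intrB !mulrDl mul1r mulN1r !e2piD -/t -/t'.
rewrite -/x; set s2 := (_)^-1; set e := e2pi (n%:~R * theta).
have -> : z * ((s2%:C * e) * (gp x + 'i * gm x)) =
    (s2%:C * e) * (z * gp x + 'i * (z * gm x)) by ring.
have -> : z * ((s2%:C * e) * ('i * gp x + gm x)) =
    (s2%:C * e) * ('i * (z * gp x) + z * gm x) by ring.
rewrite -Ep -Em /walk_p /walk_m /coin_p /coin_m.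
(* Here the roles swap: [2 * pi * x] is the dual coin angle at [n], so the phase produced by the
   shift of the walk becomes the coin of the dual. *)
have -> : e2pi x = cos (ang Phi xi n) +i* sin (ang Phi xi n) by [].
have -> : e2pi (- x) = cos (ang Phi xi n) +i* (- sin (ang Phi xi n)) by rewrite e2piN.
rewrite /q11 /q12 /q21 /q22.
move: (gp x) (gp (x + Phi)) (gp (x + - Phi)) (gm x) (gm (x + Phi)) (gm (x + - Phi)).
move: (cos _) (sin _) (lamc l1) (lamc l2) t t' e s2 => C S L1 L2.
rewrite /h.
move=> [tr ti] [sr si] [er ei] s2 [u0 u1] [u2 u3] [u4 u5] [v0 v1] [v2 v3] [v4 v5].
by congr pair; apply: complexP => /=; field.
Qed.
End walk.
End algebra.

(** * The squared modulus *)

Section sqn.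
Context {R : realType}.
Local Notation C := R[i].
Implicit Types a b : C.

Lemma sqn_ge0 a : 0 <= sqn a.
Proof. by rewrite /sqn addr_ge0// sqr_ge0. Qed.

Lemma sqnM a b : sqn (a * b) = sqn a * sqn b.
Proof. by case: a b => [a1 a2] [b1 b2]; rewrite /sqn /=; ring. Qed.

Lemma sqnN a : sqn (- a) = sqn a.
Proof. by case: a => a1 a2; rewrite /sqn /= !sqrrN. Qed.

(** Parallelogram identity: the two sides differ by [sqn (a - b)]. *)
Lemma sqnD_le a b : sqn (a + b) <= 2 * (sqn a + sqn b).
Proof.
rewrite -subr_ge0 (_ : _ - _ = sqn (a - b)) ?sqn_ge0//.
by case: a b => [a1 a2] [b1 b2]; rewrite /sqn /=; ring.
Qed.

Lemma sqn_eq0 a : sqn a = 0 -> a = 0.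
Proof.
case: a => a1 a2 /eqP; rewrite /sqn /= paddr_eq0 ?sqr_ge0//.
by rewrite !sqrf_eq0 => /andP[/eqP -> /eqP ->].
Qed.

Lemma sqn_e2pi (x : R) : sqn (e2pi x) = 1.
Proof. exact: cos2Dsin2. Qed.

Lemma e2pi1 : e2pi (1 : R) = 1.
Proof. by rewrite /e2pi mulr1 mulr_natl cos2pi sin2pi. Qed.
End sqn.

(** * Sequences tending to 0 at infinity *)

Section vanish.
Import numFieldNormedType.Exports.
Context {R : realType}.
Local Notation C := R[i].
Implicit Types f g : int -> C.
Local Open Scope classical_set_scope.

Definition vanishes_at_infinity f := forall eps : R, 0 < eps ->
  exists N0 : nat, forall n : int, (N0 <= `|n|)%N -> sqn (f n) < eps.

Lemma vanishesD f g : vanishes_at_infinity f -> vanishes_at_infinity g ->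
  vanishes_at_infinity (fun n => f n + g n).
Proof.
move=> vf vg eps e0; have e4 : 0 < eps / 4 by lra.
have [Nf hf] := vf _ e4; have [Ng hg] := vg _ e4.
exists (maxn Nf Ng) => n; rewrite geq_max => /andP[/hf fn /hg gn].
by apply: le_lt_trans (sqnD_le _ _) _; lra.
Qed.

Lemma vanishesZ (u : int -> C) (A : R) f : (forall n, sqn (u n) <= A) ->
  vanishes_at_infinity f -> vanishes_at_infinity (fun n => u n * f n).
Proof.
move=> uA vf eps e0.
have A0 : 0 <= A := le_trans (sqn_ge0 _) (uA 0).
(* The [+ 1] keeps the denominator positive when [A] is 0. *)
have [N hf] := vf (eps / (A + 1)) ltac:(by rewrite divr_gt0//; lra).
exists N => n /hf fn; rewrite sqnM.
apply: (@le_lt_trans _ _ (A * sqn (f n))); first by rewrite ler_wpM2r ?sqn_ge0.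
apply: (@le_lt_trans _ _ (A * (eps / (A + 1)))); first by rewrite ler_wpM2l// ltW.
by rewrite mulrCA gtr_pMr// ltr_pdivrMr; lra.
Qed.

Lemma vanishes_shift (k : int) f : vanishes_at_infinity f ->
  vanishes_at_infinity (fun n => f (n + k)).
Proof.
move=> vf eps /vf[N hf]; exists (N + `|k|)%N => n Nn; apply: hf.
by lia.
Qed.

(** The symmetric partial sums increase and are bounded, hence converge; the increment from [m] to
    [m + 1] dominates both terms with index [m + 1] in absolute value. *)
Lemma bounded_sum_vanishes (s : int -> R) (M : R) : (forall n, 0 <= s n) ->
  (forall N : nat, \sum_(k < (2 * N).+1) s (k%:Z - N%:Z)%R <= M) ->
  forall eps : R, 0 < eps ->
  exists N0 : nat, forall n : int, (N0 <= `|n|)%N -> s n < eps.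
Proof.
move=> s0 sM eps e0.
pose S (N : nat) := \sum_(k < (2 * N).+1) s (k%:Z - N%:Z)%R.
have SS N : S N.+1 = S N + (s N.+1%:Z + s (- N.+1%:Z)).
  rewrite /S (_ : (2 * N.+1).+1 = (2 * N).+3)%N; last by lia.
  rewrite big_ord_recl big_ord_recr /= [LHS]addrC -addrA.
  congr (_ + (s _ + s _)); rewrite /bump /=; [|lia|lia].
  by apply: eq_bigr => i _; congr s; rewrite /bump /=; lia.
have Snd : nondecreasing_seq S.
  by apply/nondecreasing_seqP => N; rewrite SS lerDl addr_ge0.
have /cvgrPdist_lt cS : S @ \oo --> sup (range S).
  by apply: nondecreasing_cvgn => //; exists M => _ [N _ <-]; exact: sM.
have [N _ hN] := cS (eps / 2) ltac:(lra).
(* The extra 1 leaves room for the predecessor [m] of the absolute value of [n]: both [S m] and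
   [S m.+1] are within [eps / 2] of the limit. *)
exists N.+1 => n Nn.
have : (0 < `|n|)%N by lia.
case En : `|n|%N Nn => [//|m] Nm _.
have := hN m; have := hN m.+1 => /=.
move=> /(_ ltac:(by lia)) h1 /(_ ltac:(by lia)) h2.
apply: (@le_lt_trans _ _ (S m.+1 - S m)).
  rewrite SS addrAC subrr add0r.
  have [->|->] : n = m.+1%:Z \/ n = - m.+1%:Z by lia.
    by rewrite lerDl.
  by rewrite lerDr.
by move: h1 h2; rewrite !ltr_norml => /andP[? ?] /andP[? ?]; lra.
Qed.
End vanish.

(** * Partial Fourier sums: algebra, periodicity and measurability *)

Section fpsum.
Context {R : realType}.
Local Notation C := R[i].
Implicit Types (f : int -> C) (x a : R) (N : nat).

Lemma fpsumD f1 f2 N x :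
  fpsum (fun n => f1 n + f2 n) N x = fpsum f1 N x + fpsum f2 N x.
Proof. by rewrite /fpsum -big_split; apply: eq_bigr => k _; rewrite mulrDr. Qed.

Lemma fpsumZ (c : C) f N x : fpsum (fun n => c * f n) N x = c * fpsum f N x.
Proof. by rewrite /fpsum mulr_sumr; apply: eq_bigr => k _; rewrite mulrCA. Qed.

Lemma fpsum_modulate a f N x :
  fpsum (fun n => e2pi (n%:~R * a) * f n) N x = fpsum f N (x + a).
Proof. by rewrite /fpsum; apply: eq_bigr => k _; rewrite mulrDr e2piD mulrA. Qed.

Lemma big_ord_shift (V : zmodType) (u : nat -> V) M :
  \sum_(k < M) u k = \sum_(k < M) u k.+1 + u 0%N - u M.
Proof.
apply/eqP; rewrite -subr_eq opprK eq_sym addrC -(big_ord_recl M (fun k => u k)).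
by rewrite big_ord_recr.
Qed.

(** Reindexing moves the window [[-N, N]] by one: the index [-N - 1] enters and [N] leaves. *)
Lemma fpsum_shiftp f N x : fpsum (fun n => f (n - 1)) N x =
  e2pi x * fpsum f N x + e2pi ((- N%:Z)%:~R * x) * f (- N%:Z - 1)
  - e2pi ((N%:Z + 1)%:~R * x) * f N%:Z.
Proof.
rewrite /fpsum (big_ord_shift
  (fun k => e2pi ((k%:Z - N%:Z)%:~R * x) * f (k%:Z - N%:Z - 1))).
rewrite sub0r (_ : (2 * N).+1%:Z - N%:Z = N%:Z + 1); last by lia.
rewrite addrK; congr (_ + _ - _).
rewrite mulr_sumr; apply: eq_bigr => k _; rewrite mulrA -e2piD.
congr (e2pi _ * f _); last by lia.
rewrite (_ : k.+1%:Z - N%:Z = 1 + (k%:Z - N%:Z)); last by lia.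
by rewrite intrD; ring.
Qed.

(** This is [fpsum_shiftp] for the sequence shifted the other way, multiplied by [e2pi (- x)] and
    solved for the shifted sum. *)
Lemma fpsum_shiftm f N x : fpsum (fun n => f (n + 1)) N x =
  e2pi (- x) * fpsum f N x + e2pi (N%:Z%:~R * x) * f (N%:Z + 1)
  - e2pi ((- N%:Z - 1)%:~R * x) * f (- N%:Z).
Proof.
have := fpsum_shiftp (fun n => f (n + 1)) N x.
rewrite (_ : (fun n => f (n - 1 + 1)) = f); last by apply/funext => n; rewrite subrK.
move=> ->; rewrite subrK mulrBr mulrDr !mulrA -!e2piD addNr.
rewrite [e2pi 0](_ : _ = 1) ?mul1r; last by rewrite /e2pi mulr0 cos0 sin0.
rewrite (_ : - x + (N%:Z + 1)%:~R * x = N%:Z%:~R * x); last by rewrite intrD; ring.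
rewrite (_ : - x + (- N%:Z)%:~R * x = (- N%:Z - 1)%:~R * x); last by rewrite intrB; ring.
by rewrite subrK addrK.
Qed.

Lemma e2pi_periodic (n : int) x : e2pi (n%:~R * (x + 1)) = e2pi (n%:~R * x).
Proof.
rewrite mulrDr mulr1 (@periodic_int _ _ (@e2pi R))// => y.
by rewrite e2piD e2pi1 mulr1.
Qed.

Lemma fpsum_periodic f N x : fpsum f N (x + 1) = fpsum f N x.
Proof. by apply: eq_bigr => k _; rewrite e2pi_periodic. Qed.

Lemma sqn_boundary_le (A : R) (a b : C) x y : sqn a <= A -> sqn b <= A ->
  sqn (e2pi x * a - e2pi y * b) <= 4 * A.
Proof.
move=> aA bA; apply: le_trans (sqnD_le _ _) _.
by rewrite sqnN !sqnM !sqn_e2pi; lra.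
Qed.

(** Stated by real and imaginary parts to match [is_inv_fourier_L2]. *)
Definition cmeasurable (g : R -> C) : Prop :=
  measurable_fun setT (fun x => complex.Re (g x)) /\
  measurable_fun setT (fun x => complex.Im (g x)).

Lemma cmeasurableD g1 g2 : cmeasurable g1 -> cmeasurable g2 ->
  cmeasurable (fun x => g1 x + g2 x).
Proof.
move=> [r1 i1] [r2 i2]; split.
- rewrite (_ : (fun _ => _) = fun x => complex.Re (g1 x) + complex.Re (g2 x)).
    exact: measurable_funD.
  by apply/funext => x; case: (g1 x) (g2 x) => [? ?] [? ?].
- rewrite (_ : (fun _ => _) = fun x => complex.Im (g1 x) + complex.Im (g2 x)).
    exact: measurable_funD.
  by apply/funext => x; case: (g1 x) (g2 x) => [? ?] [? ?].
Qed.

Lemma cmeasurableM g1 g2 : cmeasurable g1 -> cmeasurable g2 ->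
  cmeasurable (fun x => g1 x * g2 x).
Proof.
move=> [r1 i1] [r2 i2]; split.
- rewrite (_ : (fun _ => _) = fun x => complex.Re (g1 x) * complex.Re (g2 x) -
     complex.Im (g1 x) * complex.Im (g2 x)).
    by apply: measurable_funB; exact: measurable_funM.
  by apply/funext => x; case: (g1 x) (g2 x) => [? ?] [? ?].
- rewrite (_ : (fun _ => _) = fun x => complex.Re (g1 x) * complex.Im (g2 x) +
     complex.Im (g1 x) * complex.Re (g2 x)).
    by apply: measurable_funD; exact: measurable_funM.
  by apply/funext => x; case: (g1 x) (g2 x) => [? ?] [? ?].
Qed.

Lemma cmeasurable_cst c : cmeasurable (fun=> c).
Proof. by split; exact: measurable_cst. Qed.

Lemma cmeasurable_e2pi a : cmeasurable (fun x => e2pi (a * x)).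
Proof.
have m2 : measurable_fun setT (fun x : R => 2 * pi * (a * x)).
  by apply: measurable_funM => //; exact: measurable_funM.
split.
- apply: (measurableT_comp (f := @cos R)) m2.
  by apply: continuous_measurable_fun; exact: continuous_cos.
- apply: (measurableT_comp (f := @sin R)) m2.
  by apply: continuous_measurable_fun; exact: continuous_sin.
Qed.

Lemma cmeasurable_addr a g : cmeasurable g -> cmeasurable (fun x => g (x + a)).
Proof.
have ma := measurable_addr a.
by move=> [r i]; split;
  [exact: (measurableT_comp r ma)|exact: (measurableT_comp i ma)].
Qed.

Lemma cmeasurable_fpsum f N : cmeasurable (fpsum f N).
Proof.
rewrite /fpsum; elim: (index_enum _) => [|k s IH].
  by under eq_fun do rewrite big_nil; exact: cmeasurable_cst.
under eq_fun do rewrite big_cons.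
apply: cmeasurableD IH; apply: cmeasurableM (cmeasurable_cst _).
exact: cmeasurable_e2pi.
Qed.

Lemma measurable_sqn g : cmeasurable g -> measurable_fun setT (fun x => sqn (g x)).
Proof. by move=> [r i]; apply: measurable_funD; exact: measurable_funX. Qed.
End fpsum.

(** * Closure rules and uniqueness for pointwise and L^2 limits *)

Section closure.
Context {R : realType}.
Local Notation C := R[i].
Local Notation mu := lebesgue_measure.
Implicit Types (f : int -> C) (g : R -> C).

Definition sqerr f g (N : nat) (x : R) : R := sqn (fpsum f N x - g x).

(** The bound is uniform in [x], so it can be used at a fixed point or integrated over a period. The
    term [eps] absorbs boundary terms; two sources are allowed in order to cover sums. *)
Definition sqerr_dominated f1 g1 f2 g2 f g (A : R) : Prop :=
  forall eps : R, 0 < eps -> exists N0 : nat, forall N : nat, (N0 <= N)%N ->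
    forall x, sqerr f g N x <= A * (sqerr f1 g1 N x + sqerr f2 g2 N x) + eps.

Lemma sqerr_dominatedD f1 g1 f2 g2 :
  sqerr_dominated f1 g1 f2 g2 (fun n => f1 n + f2 n) (fun x => g1 x + g2 x) 2.
Proof.
move=> eps e0; exists 0%N => N _ x; rewrite /sqerr fpsumD opprD addrACA.
by apply: le_trans (sqnD_le _ _) _; rewrite lerDl ltW.
Qed.

Lemma sqerr_dominatedZ (c : C) f g :
  sqerr_dominated f g f g (fun n => c * f n) (fun x => c * g x) (sqn c).
Proof.
move=> eps e0; exists 0%N => N _ x; rewrite /sqerr fpsumZ -mulrBr sqnM.
by have := mulr_ge0 (sqn_ge0 c) (sqn_ge0 (fpsum f N x - g x)); lra.
Qed.

Lemma sqerr_dominated_shift f g (u : R -> R) (k : int) (v w : nat -> R -> R)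
    (i j : nat -> int) :
  vanishes_at_infinity f ->
  (forall N : nat, (N <= `|i N|)%N) -> (forall N : nat, (N <= `|j N|)%N) ->
  (forall N x, fpsum (fun n => f (n + k)) N x =
    e2pi (u x) * fpsum f N x + e2pi (v N x) * f (i N) - e2pi (w N x) * f (j N)) ->
  sqerr_dominated f g f g (fun n => f (n + k)) (fun x => e2pi (u x) * g x) 2.
Proof.
(* With [eps / 8] the boundary terms contribute at most [4 * (eps / 8)], which [sqnD_le] doubles to
   [eps]. *)
move=> vf iN jN fE eps e0; have [N0 hN] := vf (eps / 8) ltac:(lra).
exists N0 => N N0N x; rewrite /sqerr fE.
rewrite (_ : _ - _ = e2pi (u x) * (fpsum f N x - g x) +
  (e2pi (v N x) * f (i N) - e2pi (w N x) * f (j N))); last by ring.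
apply: le_trans (sqnD_le _ _) _; rewrite sqnM sqn_e2pi mul1r.
have fi : sqn (f (i N)) <= eps / 8 by apply/ltW/hN; exact: leq_trans (iN N).
have fj : sqn (f (j N)) <= eps / 8 by apply/ltW/hN; exact: leq_trans (jN N).
have := sqn_boundary_le (v N x) (w N x) fi fj.
by have := sqn_ge0 (fpsum f N x - g x); lra.
Qed.

Lemma sqerr_dominated_shiftp f g : vanishes_at_infinity f ->
  sqerr_dominated f g f g (fun n => f (n - 1)) (fun x => e2pi x * g x) 2.
Proof.
by move=> vf; apply: (sqerr_dominated_shift _ vf _ _ (fpsum_shiftp f)); lia.
Qed.

Lemma sqerr_dominated_shiftm f g : vanishes_at_infinity f ->
  sqerr_dominated f g f g (fun n => f (n + 1)) (fun x => e2pi (- x) * g x) 2.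
Proof.
by move=> vf; apply: (sqerr_dominated_shift _ vf _ _ (fpsum_shiftm f)); lia.
Qed.

(** All rules but modulation compare errors at the same [x], so one transfer principle along
    [sqerr_dominated] settles them. Modulation moves the argument of the error and is a separate
    assumption. *)
Lemma fourier_closed_vanishing (F : (int -> C) -> (R -> C) -> Prop) :
  (forall f1 g1 f2 g2 f g A, 0 <= A -> F f1 g1 -> F f2 g2 ->
     (forall x, g1 (x + 1) = g1 x -> g2 (x + 1) = g2 x -> g (x + 1) = g x) ->
     (cmeasurable g1 -> cmeasurable g2 -> cmeasurable g) ->
     sqerr_dominated f1 g1 f2 g2 f g A -> F f g) ->
  (forall a f g, F f g ->
     F (fun n => e2pi (n%:~R * a) * f n) (fun x => g (x + a))) ->
  fourier_closed (fun f g => F f g /\ vanishes_at_infinity f).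
Proof.
have e1 x : e2pi (x + 1) = e2pi x :> C by rewrite e2piD e2pi1 mulr1.
have e1' x : e2pi (- (x + 1)) = e2pi (- x) :> C by rewrite -(e1 (- _)) opprD subrK.
have me : cmeasurable (@e2pi R).
  by have := cmeasurable_e2pi (1 : R); under eq_fun do rewrite mul1r.
have me' : cmeasurable (fun x : R => e2pi (- x)).
  by have := cmeasurable_e2pi (-1 : R); under eq_fun do rewrite mulN1r.
move=> dom mod; split.
- move=> f1 g1 f2 g2 [F1 v1] [F2 v2]; split; last exact: vanishesD.
  apply: (dom _ _ _ _ _ _ 2 _ F1 F2 _ _ (sqerr_dominatedD _ _ _ _)) => //.
  + by move=> x -> ->.
  + exact: cmeasurableD.
- move=> c f g [Ff vf]; split; last by apply: (vanishesZ (A := sqn c)).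
  apply: (dom _ _ _ _ _ _ _ (sqn_ge0 c) Ff Ff _ _ (sqerr_dominatedZ _ _ _)).
  + by move=> x ->.
  + by move=> mg _; apply: cmeasurableM mg; exact: cmeasurable_cst.
- move=> a f g [Ff vf]; split; first exact: mod.
  by apply: (vanishesZ (A := 1)) vf => n; rewrite sqn_e2pi.
- move=> f g [Ff vf]; split; last exact: vanishes_shift.
  apply: (dom _ _ _ _ _ _ 2 _ Ff Ff _ _ (sqerr_dominated_shiftp _ vf)) => //.
  + by move=> x -> _; rewrite e1.
  + by move=> mg _; exact: cmeasurableM.
- move=> f g [Ff vf]; split; last exact: vanishes_shift.
  apply: (dom _ _ _ _ _ _ 2 _ Ff Ff _ _ (sqerr_dominated_shiftm _ vf)) => //.
  + by move=> x -> _; rewrite e1'.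
  + by move=> mg _; exact: cmeasurableM.
Qed.

Lemma fourier_closed_pw :
  fourier_closed (fun f g => is_inv_fourier_pw f g /\ vanishes_at_infinity f).
Proof.
apply: fourier_closed_vanishing.
- move=> f1 g1 f2 g2 f g A A0 F1 F2 _ _ dom x eps e0.
  (* This choice keeps the dominated part at most [eps / 2], also for [A] equal to 0; the boundary
     part adds [eps / 4]. *)
  have e4 : 0 < eps / (4 * (A + 1)) by rewrite divr_gt0//; lra.
  have [N1 h1] := F1 x _ e4; have [N2 h2] := F2 x _ e4.
  have [N3 h3] := dom (eps / 4) ltac:(lra).
  exists (maxn N1 (maxn N2 N3)) => N.
  rewrite !geq_max => /and3P[/h1 {}h1 /h2 {}h2 /h3 {}h3].
  apply: le_lt_trans (h3 x) _; rewrite /sqerr.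
  have : A * (sqn (fpsum f1 N x - g1 x) + sqn (fpsum f2 N x - g2 x)) <=
      (A + 1) * (eps / (4 * (A + 1)) + eps / (4 * (A + 1))).
    by apply: ler_pM => //; [rewrite addr_ge0// sqn_ge0|lra|lra].
  have -> : (A + 1) * (eps / (4 * (A + 1)) + eps / (4 * (A + 1))) = eps / 2.
    by field; lra.
  by lra.
- move=> a f g Ff x eps e0; have [N0 h] := Ff (x + a) _ e0.
  by exists N0 => N /h; rewrite fpsum_modulate.
Qed.

(** Both values are compared with a common partial sum; errors below [e / 4] give
    [2 * (e / 4 + e / 4) = e]. *)
Lemma is_inv_fourier_pw_unique f g g' :
  is_inv_fourier_pw f g -> is_inv_fourier_pw f g' -> forall x, g x = g' x.
Proof.
move=> Fg Fg' x; apply/subr0_eq/sqn_eq0/eqP; rewrite eq_le sqn_ge0 andbT.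
apply/ler_addgt0Pl => e e0; rewrite addr0.
have [N hN] := Fg x (e / 4) ltac:(lra); have [N' hN'] := Fg' x (e / 4) ltac:(lra).
have {}hN := hN (maxn N N') (leq_maxl _ _); have {}hN' := hN' (maxn N N') (leq_maxr _ _).
rewrite (_ : g x - g' x =
  - (fpsum f (maxn N N') x - g x) + (fpsum f (maxn N N') x - g' x)); last by ring.
by apply: le_trans (sqnD_le _ _) _; rewrite sqnN; lra.
Qed.

(** Integrates a pointwise domination over one period; the constant [c] is kept because the interval
    has length 1. *)
Lemma le_integral01_comb (h h1 h2 : R -> R) (A c e : R) :
  measurable_fun setT h -> measurable_fun setT h1 -> measurable_fun setT h2 ->
  (forall x, 0 <= h x) -> (forall x, 0 <= h1 x) -> (forall x, 0 <= h2 x) ->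
  0 <= A -> 0 <= c -> (forall x, h x <= A * (h1 x + h2 x) + c) ->
  (\int[mu]_(x in `[0%R, 1%R]) (h1 x)%:E < e%:E)%E ->
  (\int[mu]_(x in `[0%R, 1%R]) (h2 x)%:E < e%:E)%E ->
  (\int[mu]_(x in `[0%R, 1%R]) (h x)%:E <= (A * (e + e) + c)%:E)%E.
Proof.
move=> mh mh1 mh2 h0 h10 h20 A0 c0 hle i1 i2.
have mE (k : R -> R) : measurable_fun setT k ->
    measurable_fun (`[0%R, 1%R]%classic : set R) (fun x => (k x)%:E).
  by move=> mk; apply/measurable_EFinP; exact: measurable_funTS.
have m12 : measurable_fun setT (fun x => h1 x + h2 x) by exact: measurable_funD.
apply: (@le_trans _ _ (\int[mu]_(x in `[0%R, 1%R])
   (A%:E * ((h1 x)%:E + (h2 x)%:E) + c%:E))%E).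
  apply: ge0_le_integral => //.
  - by move=> x _; rewrite lee_fin.
  - exact: mE.
  - have := mE (fun x => A * (h1 x + h2 x) + c); apply.
    by apply: measurable_funD => //; exact: measurable_funM.
  - by move=> x _; rewrite lee_fin.
rewrite ge0_integralD//; last 2 first.
- by move=> x _; rewrite lee_fin mulr_ge0// addr_ge0.
- by apply: (mE (fun x => A * (h1 x + h2 x))); exact: measurable_funM.
rewrite ge0_integralZl_EFin//; last 2 first.
- by move=> x _; rewrite lee_fin addr_ge0.
- exact: (mE (fun x => h1 x + h2 x)).
rewrite ge0_integralD//; [|by move=> x _; rewrite lee_fin|exact: mE
  |by move=> x _; rewrite lee_fin|exact: mE].
rewrite integral_cst//= lebesgue_measure_itv/= lte_fin ltr01 sube0 mule1.
rewrite EFinD EFinM EFinD; apply: leeD => //.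
by apply: lee_wpmul2l => //; apply: leeD; exact: ltW.
Qed.

Lemma measurable_sqerr f g N : cmeasurable g -> measurable_fun setT (sqerr f g N).
Proof.
move=> mg; apply: measurable_sqn; apply: cmeasurableD (cmeasurable_fpsum _ _) _.
have := cmeasurableM (cmeasurable_cst (-1)) mg.
by under eq_fun do rewrite mulN1r.
Qed.

Lemma fourier_closed_L2 :
  fourier_closed (fun f g => is_inv_fourier_L2 f g /\ vanishes_at_infinity f).
Proof.
apply: fourier_closed_vanishing.
- move=> f1 g1 f2 g2 f g A A0 [p1 mr1 mi1 F1] [p2 mr2 mi2 F2] pg mg dom.
  have m1 : cmeasurable g1 by []. have m2 : cmeasurable g2 by [].
  have {}mg := mg m1 m2; case: (mg) => mr mi; split => //.
    by move=> x; apply: pg.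
  move=> eps e0.
  have e4 : 0 < eps / (4 * (A + 1)) by rewrite divr_gt0//; lra.
  have [N1 h1] := F1 _ e4; have [N2 h2] := F2 _ e4.
  have [N3 h3] := dom (eps / 4) ltac:(lra).
  exists (maxn N1 (maxn N2 N3)) => N.
  rewrite !geq_max => /and3P[/h1 {}h1 /h2 {}h2 /h3 {}h3].
  apply: le_lt_trans (le_integral01_comb (h := sqerr f g N) (measurable_sqerr _ _ mg)
    (measurable_sqerr _ _ m1) (measurable_sqerr _ _ m2) _ _ _ A0 _ h3 h1 h2) _;
    do ?[by move=> x; exact: sqn_ge0]; first lra.
  rewrite lte_fin.
  have : A * (eps / (4 * (A + 1)) + eps / (4 * (A + 1))) <= eps / 2.
    have -> : eps / 2 = (A + 1) * (eps / (4 * (A + 1)) + eps / (4 * (A + 1))).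
      by field; lra.
    by rewrite ler_wpM2r; lra.
  by lra.
- move=> a f g [p mr mi F].
  have mg : cmeasurable g by [].
  have [mr' mi'] := cmeasurable_addr a mg.
  split => //; first by move=> x; rewrite addrAC p.
  (* Halving [eps] pays for the factor 2 in [ge0_integral_periodic_addr]. *)
  move=> eps e0; have [N0 hN] := F (eps / 2) ltac:(lra); exists N0 => N /hN {}hN.
  under eq_integral do rewrite fpsum_modulate.
  have := @ge0_integral_periodic_addr R (fun x => (sqerr f g N x)%:E) a _ _ _.
  move=> /(_ _ _ _)/le_lt_trans; apply.
  + by apply/measurable_EFinP; exact: measurable_sqerr.
  + by move=> x; rewrite lee_fin sqn_ge0.
  + by move=> x; rewrite /sqerr fpsum_periodic p.
  + rewrite (_ : eps = 2 * (eps / 2)); last by field.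
    by rewrite EFinM lte_pmul2l// ?lte_fin.
Qed.

(** Comparison with a common partial sum makes the integral of [d] over a period smaller than any
    [e]; periodicity extends the conclusion to the line. *)
Lemma is_inv_fourier_L2_unique f g g' :
  is_inv_fourier_L2 f g -> is_inv_fourier_L2 f g' ->
  {ae mu, forall x, g x = g' x}.
Proof.
move=> [p mr mi F] [p' mr' mi' F'].
have mg : cmeasurable g by []. have mg' : cmeasurable g' by [].
pose d x := sqn (g x - g' x).
have md : measurable_fun setT d.
  apply: measurable_sqn; apply: cmeasurableD mg _.
  have := cmeasurableM (cmeasurable_cst (-1)) mg'.
  by under eq_fun do rewrite mulN1r.
have : {ae mu, forall x, (d x)%:E = 0%E}; last first.
  apply: (@filterS _ _ (ae_filter_ringOfSetsType (@lebesgue_measure R))).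
  by move=> x /eqP; rewrite eqe => /eqP/sqn_eq0/subr0_eq.
apply: ae_periodic_eq0.
- exact/measurable_EFinP.
- by move=> x; rewrite lee_fin sqn_ge0.
- by move=> x; rewrite /d p p'.
- apply/eqP; rewrite eq_le integral_ge0 ?andbT; last first.
    by move=> x _; rewrite lee_fin sqn_ge0.
  apply/lee_addgt0Pr => e e0; rewrite add0e.
  have [N hN] := F (e / 4) ltac:(lra); have [N' hN'] := F' (e / 4) ltac:(lra).
  have {}hN := hN (maxn N N') (leq_maxl _ _); have {}hN' := hN' (maxn N N') (leq_maxr _ _).
  have := @le_integral01_comb d _ _ 2 0 (e / 4) md (measurable_sqerr _ _ mg)
    (measurable_sqerr _ _ mg') _ _ _ _ _ _ hN hN'.
  rewrite (_ : 2 * (e / 4 + e / 4) + 0 = e); last by field.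
  apply => // x; do ?exact: sqn_ge0.
  rewrite addr0 /d (_ : g x - g' x =
    - (fpsum f (maxn N N') x - g x) + (fpsum f (maxn N N') x - g' x)); last by ring.
  by apply: le_trans (sqnD_le _ _) _; rewrite sqnN.
Qed.
End closure.

(** * From the eigenvalue equation to the dual equation *)

(** In each pair both functions transform the same sequence, so uniqueness of limits equates them.
    Translating by [a], later [n * Phi], puts the resulting null set directly in the variable
    [xi]. *)
Lemma eigen_fourier_dual (R : realType) (P : (int -> R[i]) -> (R -> R[i]) -> Prop)
    (l1 l2 Phi theta a : R) (psi : cseq2 R) (z : R[i]) (gp gm : R -> R[i]) :
  fourier_closed P -> P (fun n => (psi n).1) gp -> P (fun n => (psi n).2) gm ->
  (forall n : int, Wamo l1 l2 Phi theta psi n = (z * (psi n).1, z * (psi n).2)) ->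
  (exists2 f, P f (fun x => walk_p l1 l2 Phi theta gp gm (x + a)) &
     P f (fun x => z * gp (x + a))) /\
  (exists2 f, P f (fun x => walk_m l1 l2 Phi theta gp gm (x + a)) &
     P f (fun x => z * gm (x + a))).
Proof.
move=> fc Pp Pm eigen.
have [Wp Wm] := fourier_closed_walk l1 l2 Phi theta fc Pp Pm.
rewrite (_ : (fun _ => _) = fun n => z * (psi n).1) in Wp; last first.
  by apply/funext => n; rewrite eigen.
rewrite (_ : (fun _ => _) = fun n => z * (psi n).2) in Wm; last first.
  by apply/funext => n; rewrite eigen.
split; eexists.
- exact: (fcM fc a Wp).
- exact: (fcM fc a (fcZ fc z Pp)).
- exact: (fcM fc a Wm).
- exact: (fcM fc a (fcZ fc z Pm)).
Qed.

Lemma is_l2_vanishes (R : realType) (psi : cseq2 R) : is_l2 psi ->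
  vanishes_at_infinity (fun n => (psi n).1) /\
  vanishes_at_infinity (fun n => (psi n).2).
Proof.
move=> [M sM].
have s0 n : 0 <= sqn (psi n).1 + sqn (psi n).2 by rewrite addr_ge0 ?sqn_ge0.
split=> eps /(bounded_sum_vanishes s0 sM)[N0 hN]; exists N0 => n /hN;
  by apply: le_lt_trans; rewrite ?lerDl ?lerDr sqn_ge0.
Qed.

Theorem theorem2p2 (R : realType) (l1 l2 Phi theta : R) (psi : cseq2 R) (z : R[i]) :
  0 <= l1 <= 1 -> 0 <= l2 <= 1 ->
  irrational Phi ->
  is_l2 psi ->
  sqn z = 1 ->
  (forall n : int, Wamo l1 l2 Phi theta psi n = (z * (psi n).1, z * (psi n).2)) ->
  (forall gp gm : R -> R[i],
      is_inv_fourier_L2 (fun n => (psi n).1) gp ->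
      is_inv_fourier_L2 (fun n => (psi n).2) gm ->
      {ae lebesgue_measure, forall xi : R, forall n : int,
         Wsharp l1 l2 Phi xi (phixi Phi theta gp gm xi) n
         = (z * (phixi Phi theta gp gm xi n).1, z * (phixi Phi theta gp gm xi n).2)})
  /\
  (is_l1 psi ->
   forall gp gm : R -> R[i],
      is_inv_fourier_pw (fun n => (psi n).1) gp ->
      is_inv_fourier_pw (fun n => (psi n).2) gm ->
      forall xi : R, forall n : int,
         Wsharp l1 l2 Phi xi (phixi Phi theta gp gm xi) n
         = (z * (phixi Phi theta gp gm xi n).1, z * (phixi Phi theta gp gm xi n).2)).
Proof.
move=> _ _ _ /is_l2_vanishes[vp vm] _ eigen; split=> [gp gm Fp Fm|_ gp gm Fp Fm xi n].
- have ae_n n : {ae lebesgue_measure, forall xi : R,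
      Wsharp l1 l2 Phi xi (phixi Phi theta gp gm xi) n
      = (z * (phixi Phi theta gp gm xi n).1, z * (phixi Phi theta gp gm xi n).2)}.
    have [[f [Fw _] [Fz _]] [f' [Fw' _] [Fz' _]]] := eigen_fourier_dual
      (n%:~R * Phi) (fourier_closed_L2 (R := R)) (conj Fp vp) (conj Fm vm) eigen.
    have aep := is_inv_fourier_L2_unique Fw Fz.
    have aem := is_inv_fourier_L2_unique Fw' Fz'.
    apply: (@filterS2 _ _ (ae_filter_ringOfSetsType (@lebesgue_measure R)) _ _ _ _ aep aem).
    by move=> xi /= ep em; apply: Wsharp_phixi; rewrite addrC.
  (* The null set found above depends on [n]; a countable union over the integers gives one null set
     valid for all [n]. *)
  have := ae_foralln (fun k => ae_n (odflt 0 (unpickle k))).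
  apply: (@filterS _ _ (ae_filter_ringOfSetsType (@lebesgue_measure R))).
  by move=> xi /= hxi n; have := hxi (pickle n); rewrite pickleK.
- have [[f [Fw _] [Fz _]] [f' [Fw' _] [Fz' _]]] := eigen_fourier_dual
    (n%:~R * Phi) (fourier_closed_pw (R := R)) (conj Fp vp) (conj Fm vm) eigen.
  apply: Wsharp_phixi; rewrite addrC.
  + exact: (is_inv_fourier_pw_unique Fw Fz).
  + exact: (is_inv_fourier_pw_unique Fw' Fz').
Qed.
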